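(* Let $1\le p<\infty$, let $\mathbb{X}=(X,\mathcal{M},\mu)$ be a complete decomposable measure space, and let $\mathscr{G}$ be a collection of generators for $\mathbb{X}$. Then the following are equivalent: (i) $(\mathbb{X},\mathscr{G})$ has the finite chain property and is $\sigma$-decomposable; (ii) $\|\cdot\|_{\mathrm{BMO}^p_{\mathscr{G}}(\mathbb{X})}$ is a norm modulo constants on $\mathrm{BMO}^p_{\mathscr{G}}(\mathbb{X})$; (iii) $\mathrm{BMO}^p_{\mathscr{G}}(\mathbb{X})$ is a Banach space modulo constants.
   Context: Setting: $\mathbb{X}=(X,\mathcal{M},\mu)$ is a nontrivial (i.e. $\mu(X)>0$) semifinite measure space and $\mathcal{M}^*=\{E\in\mathcal{M}:0<\mu(E)<\infty\}$. A collection of generators is a collection $\mathscr{G}\subset\mathcal{M}^*$ that covers $X$; its elements are called generators. ''Complete'' for the measure space means that subsets of null sets are measurable. For $1\le p<\infty$, $L^p_{\mathrm{loc}}(\mathbb{X},\mathscr{G})$ is the space of measurable $f:X\to\mathbb{R}$ with $\int_G|f|^p\,d\mu<\infty$ for every $G\in\mathscr{G}$. Write $f_G=\frac{1}{\mu(G)}\int_G f\,d\mu$. The space $\mathrm{BMO}^p_{\mathscr{G}}(\mathbb{X})$ consists of those $f\in L^p_{\mathrm{loc}}(\mathbb{X},\mathscr{G})$ with $$\|f\|_{\mathrm{BMO}^p_{\mathscr{G}}(\mathbb{X})}=\sup_{G\in\mathscr{G}}\left(\frac{1}{\mu(G)}\int_G|f-f_G|^p\,d\mu\right)^{1/p}<\infty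 .$$ This is a seminorm vanishing on functions that are a.e. equal to a constant. It is a norm modulo constants if $\|f\|_{\mathrm{BMO}^p_{\mathscr{G}}(\mathbb{X})}=0$ implies that $f$ equals a constant a.e. on $X$. The space is a Banach space modulo constants if, in addition, the quotient by the functions that are a.e. constant is complete. Decomposable: there is a partition $\{X_\omega\}_{\omega\in\Omega}$ of $X$ (pairwise disjoint nonempty sets in $\mathcal{M}$ with union $X$; $\Omega$ not necessarily countable), called a decomposition of $\mathbb{X}$, such that (a) $\mu(X_\omega)<\infty$ for all $\omega$; (b) if $A\subset X$ and $A\cap X_\omega\in\mathcal{M}$ for all $\omega$, then $A\in\mathcal{M}$; (c) $\mu(E)=\sum_{\omega\in\Omega}\mu(E\cap X_\omega)$ for every $E\in\mathcal{M}$ (the sum being the supremum of sums over finite subfamilies). $\sigma$-decomposable: $(\mathbb{X},\mathscr{G})$ is $\sigma$-decomposable if there is a decomposition $\{X_\omega\}_{\omega\in\Omega}$ of $\mathbb{X}$ such that for every $\omega\in\Omega$ there is a countable $\mathscr{G}_\omega\subset\mathscr{G}$ with $\mu\big(X_\omega\setminus\bigcup_{G\in\mathscr{G}_\omega}G\big)=0$. Finite chain property (FCP): a finite chain is a finite family $\{G_n\}_{n=0}^N\subset\mathscr{G}$ with $\mu(G_{n-1}\cap G_n)>0$ for all $1\le n\le N$. $(\mathbb{X},\mathscr{G})$ has the FCP if for all $G,G'\in\mathscr{G}$ there is a finite chain $\{G_n\}_{n=0}^N$ with $G_0=G$ and $G_N=G'$. *)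

(* Defs.v *)
From HB Require Import structures.
From mathcomp Require Import all_boot all_order all_algebra.
From mathcomp Require Import all_classical all_reals all_analysis.
Import Order.TTheory GRing.Theory Num.Theory.
Import numFieldNormedType.Exports.

Set Implicit Arguments.
Unset Strict Implicit.
Unset Printing Implicit Defensive.

Local Open Scope classical_set_scope.
Local Open Scope ring_scope.
Local Open Scope ereal_scope.

Section MeasureSpace.
Context (R : realType) (d : measure_display) (T : measurableType d).
Variable mu : {measure set T -> \bar R}.

Definition nontrivial_measure : Prop := 0 < mu [set: T].

Definition semifinite : Prop := forall E, measurable E -> mu E = +oo ->
  exists F, [/\ measurable F, F `<=` E, 0 < mu F & mu F < +oo].

(* [partition] includes nonemptiness of the pieces; [\esum] is the supremum of
   the sums over finite subfamilies.  The index type is an arbitrary choiceType,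
   which, classically, is no restriction on its cardinality. *)
Definition decomposition (Omega : choiceType) (X : Omega -> set T) : Prop :=
  [/\ partition [set: Omega] X [set: T],
      forall w, measurable (X w),
      forall w, mu (X w) < +oo,
      forall A : set T, (forall w, measurable (A `&` X w)) -> measurable A &
      forall E, measurable E ->
        mu E = \esum_(w in [set: Omega]) mu (E `&` X w)].

Definition decomposable : Prop :=
  exists (Omega : choiceType) (X : Omega -> set T), decomposition X.

Definition generators (GG : set (set T)) : Prop :=
  (forall G, GG G -> [/\ measurable G, 0 < mu G & mu G < +oo]) /\
  \bigcup_(G in GG) G = [set: T].

Definition sigma_decomposable (GG : set (set T)) : Prop :=
  exists (Omega : choiceType) (X : Omega -> set T), decomposition X /\
    forall w, exists Gw : set (set T),
      [/\ countable Gw, Gw `<=` GG & mu (X w `\` \bigcup_(G in Gw) G) = 0].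

Definition finite_chain (GG : set (set T)) (N : nat) (c : nat -> set T) : Prop :=
  (forall n, (n <= N)%N -> GG (c n)) /\
  (forall n, (1 <= n <= N)%N -> 0 < mu (c n.-1 `&` c n)).

Definition finite_chain_property (GG : set (set T)) : Prop :=
  forall G G', GG G -> GG G' ->
    exists N c, [/\ finite_chain GG N c, c 0%N = G & c N = G'].

Definition Lploc (p : R) (GG : set (set T)) : set (T -> R) :=
  [set f : T -> R | measurable_fun [set: T] f /\
    forall G, GG G -> \int[mu]_(x in G) (`|f x| `^ p)%:E < +oo].

Definition mean (G : set T) (f : T -> R) : R :=
  ((fine (mu G))^-1 * \int[mu]_(x in G) f x)%R.

Definition bmo_norm (p : R) (GG : set (set T)) (f : T -> R) : \bar R :=
  ereal_sup [set ((fine (mu G))^-1%:E *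
      \int[mu]_(x in G) (`|f x - mean G f| `^ p)%:E) `^ p^-1 | G in GG].

Definition BMO (p : R) (GG : set (set T)) : set (T -> R) :=
  [set f : T -> R | Lploc p GG f /\ bmo_norm p GG f < +oo].

Definition ae_constant (f : T -> R) : Prop :=
  exists c : R, \forall x \ae mu, f x = c.

Definition norm_modulo_constants (p : R) (GG : set (set T)) : Prop :=
  forall f, BMO p GG f -> bmo_norm p GG f = 0 -> ae_constant f.

(* The quotient of BMO by the a.e. constant functions: its elements are the
   cosets, with coset-wise difference and the usual quotient (semi)norm. *)
Definition bmo_coset (p : R) (GG : set (set T)) (f : T -> R) : set (T -> R) :=
  [set g : T -> R | BMO p GG g /\ ae_constant (g \- f)%R].

Definition bmo_quotient (p : R) (GG : set (set T)) : set (set (T -> R)) :=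
  [set bmo_coset p GG f | f in BMO p GG].

Definition coset_sub (C D : set (T -> R)) : set (T -> R) :=
  [set (f \- g)%R | f in C & g in D].

Definition quotient_norm (p : R) (GG : set (set T)) (C : set (T -> R)) : \bar R :=
  ereal_inf [set bmo_norm p GG f | f in C].

Definition quotient_complete (p : R) (GG : set (set T)) : Prop :=
  forall u : nat -> set (T -> R),
    (forall n, bmo_quotient p GG (u n)) ->
    (forall e : R, (0 < e)%R -> exists N, forall m n, (N <= m)%N -> (N <= n)%N ->
       quotient_norm p GG (coset_sub (u m) (u n)) < e%:E) ->
    exists2 C, bmo_quotient p GG C &
      quotient_norm p GG (coset_sub (u n) C) @[n --> \oo] --> 0.

Definition Banach_modulo_constants (p : R) (GG : set (set T)) : Prop :=
  norm_modulo_constants p GG /\ quotient_complete p GG.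

End MeasureSpace.

(* Main.v *)
Require Import Defs.
From mathcomp Require Import all_boot all_order all_algebra.
From mathcomp Require Import all_classical all_reals all_analysis.
From mathcomp Require Import measurable_realfun.
From mathcomp Require Import ring lra.
Import Order.TTheory GRing.Theory Num.Theory.
Import numFieldNormedType.Exports.

Local Open Scope classical_set_scope.
Local Open Scope ring_scope.

(** The seminorm of f vanishes exactly when f is a.e. equal to its mean on
    every generator ([bmo_norm_eq0P]); the theorem is about when these local
    constants are forced to agree, and to be a constant on the whole space.

    Suppose chains exist and the space is sigma-decomposable.  Two generators
    that overlap in positive measure carry the same constant, hence so do the
    two ends of a chain, so there is one constant c with f = c a.e. on each
    generator.  On a piece of the decomposition countably many generators
    cover almost everything, so f = c a.e. there, and null sets of a
    decomposable space are detected piecewise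
    ([chain_sigma_norm_modulo_constants]).

    Conversely, a decomposable space has essential unions of arbitrary,
    possibly uncountable, families of generators: on a piece, which has finite
    measure, choose a countable subfamily whose union has the largest possible
    measure, and glue the pieces ([essential_union]).  Let A be the essential
    union of the generators chained to a given G.  A generator is a.e. inside A
    if it is chained to G, and a.e. outside A otherwise, so the indicator of A
    has seminorm 0; if it is a.e. constant, no generator lies outside A, which
    is the finite chain property.  Let now A be the essential union of all
    generators.  Its indicator again has seminorm 0, so A has full measure, and
    the countable families which produced A witness sigma-decomposability.

    For completeness ([bmo_cauchy_cvg]), fix a generator G0 and subtract
    constants so that all functions F n of the Cauchy sequence have mean 0 on
    G0.  Along a chain the means of h on consecutive generators differ by at
    most a constant times the seminorm of h, because both are close to h in
    average on the overlap.  Hence for each G there is K with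
    int_G |h| <= K |h|_BMO for all h of mean 0 on G0
    ([norm_integral_le_bmo]).  A subsequence whose increments have seminorm at
    most 2^-k therefore has summable increments in L^1(G) for every G at once,
    so it converges a.e. on every G, and dominated convergence gives the
    convergence of its means.  The limit is defined everywhere by an upper
    limit, so no gluing is needed, and Fatou's lemma carries the p-th power
    bounds to the limit ([oscillation_fatou]).  Working in L^1 for the
    convergence and using Fatou only for the exponent p avoids both Hoelder's
    inequality and the completeness of L^p: the comparison of L^1 with L^p
    averages reduces to the pointwise bound [le_powR_affine]. *)

(** * Pointwise inequalities for powers *)

Section PowerInequalities.
Context {R : realType} {p : R}.
Hypothesis hp : 1 <= p.

Let p_gt0 : 0 < p. Proof. exact: lt_le_trans ltr01 hp. Qed.

(** |a + b| is at most twice the larger of |a| and |b|; the constant 2^p is not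
    sharp, but only finiteness is ever deduced from it. *)
Lemma normr_powRD (a b : R) :
  `|a + b| `^ p <= 2 `^ p * (`|a| `^ p + `|b| `^ p).
Proof.
have key (u v : R) : `|u| <= `|v| ->
    `|u + v| `^ p <= 2 `^ p * (`|u| `^ p + `|v| `^ p).
  move=> uv; apply: (@le_trans _ _ ((2 * `|v|) `^ p)).
    apply: ge0_ler_powR; rewrite ?nnegrE ?normr_ge0 ?mulr_ge0 ?(ltW p_gt0) //.
    by apply: le_trans (ler_normD _ _) _; lra.
  rewrite powRM ?normr_ge0 //.
  by apply: ler_wpM2l; rewrite ?powR_ge0 // lerDr powR_ge0.
have [ab|/ltW ba] := leP `|a| `|b|; first exact: key.
by rewrite addrC [_ `^ p + _]addrC; exact: key.
Qed.

(** Substitute for Hoelder's inequality: if t > a then t = t^(1-p) t^p, and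
    t^(1-p) <= a^(1-p) because 1 - p <= 0.  Taking for a the size of the
    L^p average bounds the L^1 average by 2a. *)
Lemma le_powR_affine (a t : R) : 0 < a -> 0 <= t ->
  t <= a + a `^ (1 - p) * t `^ p.
Proof.
move=> a0 t0; have [ta|at'] := leP t a.
  by apply: (le_trans ta); rewrite lerDl mulr_ge0 // powR_ge0.
apply: (@le_trans _ _ (a `^ (1 - p) * t `^ p)); last by rewrite lerDr ltW.
have t0' : 0 < t by exact: lt_trans at'.
rewrite -(mulr_powRB1 t0 p_gt0) mulrCA ler_peMr //.
have -> : 1 - p = - (p - 1) by ring.
rewrite powRN mulrC ler_pdivlMr ?powR_gt0 // mul1r.
by apply: ge0_ler_powR; rewrite ?nnegrE ?subr_ge0 // ltW.
Qed.

End PowerInequalities.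

(** * Means and oscillations on a set of finite positive measure *)

Section Definitions.
Context {R : realType} {d : measure_display} {T : measurableType d}.
Variable mu : {measure set T -> \bar R}.

Definition finite_positive (G : set T) : Prop :=
  [/\ measurable G, (0 < mu G)%E & (mu G < +oo)%E].

(** The integral inside the BMO norm, before normalization by the measure of G
    and before taking the root, so that it is monotone and continuous along
    sequences by the usual integral theorems. *)
Definition oscillation (p : R) (G : set T) (f : T -> R) : \bar R :=
  (\int[mu]_(x in G) (`|f x - mean mu G f| `^ p)%:E)%E.

End Definitions.

Section Averages.
Context {R : realType} {d : measure_display} {T : measurableType d}.
Context {mu : {measure set T -> \bar R}} {p : R}.
Hypothesis hp : 1 <= p.
Implicit Types (G : set T) (f g h : T -> R).

Let p_gt0 : 0 < p. Proof. exact: lt_le_trans ltr01 hp. Qed.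

Lemma finite_positive_fine {G} : finite_positive mu G ->
  mu G = (fine (mu G))%:E /\ 0 < fine (mu G).
Proof.
move=> [mG G0 Goo]; split; first by rewrite fineK // ge0_fin_numE.
by rewrite fine_gt0 // G0 Goo.
Qed.

Lemma measurable_normp {D : set T} {f} : measurable_fun D f ->
  measurable_fun D (fun x => (`|f x| `^ p)%:E).
Proof.
move=> mf; apply/measurable_EFinP.
apply: (measurableT_comp (measurable_powR p)).
exact: measurableT_comp.
Qed.

Lemma measurable_norm {D : set T} {f} : measurable_fun D f ->
  measurable_fun D (fun x => `|f x|%:E).
Proof. by move=> mf; apply/measurable_EFinP; exact: measurableT_comp. Qed.

Lemma integral_normpD {G f g} : measurable G ->
  measurable_fun G f -> measurable_fun G g ->
  (\int[mu]_(x in G) (`|f x + g x| `^ p)%:E <= (2 `^ p)%:E *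
    (\int[mu]_(x in G) (`|f x| `^ p)%:E + \int[mu]_(x in G) (`|g x| `^ p)%:E))%E.
Proof.
move=> mG mf mg.
rewrite -ge0_integralD //; try exact: measurable_normp.
rewrite -ge0_integralZl_EFin ?powR_ge0 //; first last.
- by apply: emeasurable_funD; exact: measurable_normp.
- by move=> x _; rewrite adde_ge0 // lee_fin powR_ge0.
apply: ge0_le_integral => //.
- exact/measurable_normp/measurable_funD.
- apply: measurable_funeM; apply: emeasurable_funD; exact: measurable_normp.
- by move=> x _; rewrite -EFinD -EFinM lee_fin normr_powRD.
Qed.

Lemma integral_normpD_lty {G} f g : measurable G ->
  measurable_fun G f -> measurable_fun G g ->
  (\int[mu]_(x in G) (`|f x| `^ p)%:E < +oo)%E ->
  (\int[mu]_(x in G) (`|g x| `^ p)%:E < +oo)%E ->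
  (\int[mu]_(x in G) (`|f x + g x| `^ p)%:E < +oo)%E.
Proof.
move=> mG mf mg fp gp; apply: le_lt_trans (integral_normpD mG mf mg) _.
by rewrite lte_mul_pinfty ?lee_fin ?powR_ge0 // lte_add_pinfty.
Qed.

Lemma integral_normp_cst G (c : R) : measurable G ->
  (\int[mu]_(x in G) (`|c| `^ p)%:E = (`|c| `^ p)%:E * mu G)%E.
Proof. by move=> mG; rewrite integral_cst. Qed.

Lemma integral_norm_affine {G f} {a : R} : measurable G -> measurable_fun G f ->
  0 < a ->
  (\int[mu]_(x in G) `|f x|%:E <=
    a%:E * mu G + (a `^ (1 - p))%:E * \int[mu]_(x in G) (`|f x| `^ p)%:E)%E.
Proof.
move=> mG mf a0.
rewrite -ge0_integralZl_EFin ?powR_ge0 //; last exact: measurable_normp.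
rewrite -integral_cst // -ge0_integralD //; first last.
- by apply: measurable_funeM; exact: measurable_normp.
- by move=> x _; rewrite mule_ge0 // lee_fin powR_ge0.
- by move=> x _; rewrite lee_fin ltW.
apply: ge0_le_integral => //.
- exact: measurable_norm.
- apply: emeasurable_funD => //; apply: measurable_funeM; exact: measurable_normp.
- by move=> x _; rewrite -EFinM -EFinD lee_fin le_powR_affine.
Qed.

Lemma Lp_integrable {G f} : measurable G -> (mu G < +oo)%E ->
  measurable_fun G f -> (\int[mu]_(x in G) (`|f x| `^ p)%:E < +oo)%E ->
  mu.-integrable G (EFin \o f).
Proof.
move=> mG Goo mf fp; apply/integrableP; split; first exact/measurable_EFinP.
apply: le_lt_trans (integral_norm_affine mG mf ltr01) _.
by rewrite lte_add_pinfty // lte_mul_pinfty ?lee_fin ?powR_ge0.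
Qed.

Lemma meanB {G f g} : measurable G ->
  mu.-integrable G (EFin \o f) -> mu.-integrable G (EFin \o g) ->
  mean mu G (f \- g) = mean mu G f - mean mu G g.
Proof. by move=> mG fi gi; rewrite /mean RintegralB // mulrBr. Qed.

Lemma integrable_cst_finite_positive {G} (c : R) : finite_positive mu G ->
  mu.-integrable G (EFin \o cst c).
Proof.
move=> [mG G0 Goo]; apply: Lp_integrable => //.
change (\int[mu]_(x in G) (`|c| `^ p)%:E < +oo)%E.
by rewrite integral_normp_cst // lte_mul_pinfty ?lee_fin ?powR_ge0.
Qed.

Lemma mean_cst {G} (c : R) : finite_positive mu G -> mean mu G (cst c) = c.
Proof.
move=> gG; have [mG _ _] := gG; have [_ m0] := finite_positive_fine gG.
by rewrite /mean Rintegral_cst // mulrCA mulVf ?mulr1 // gt_eqF.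
Qed.

Lemma eq_mean {G f g} : measurable G ->
  measurable_fun G f -> measurable_fun G g ->
  (\forall x \ae mu, G x -> f x = g x) -> mean mu G f = mean mu G g.
Proof.
move=> mG mf mg fg; rewrite /mean; congr (_ * fine _).
apply: ae_eq_integral => //; try exact/measurable_EFinP.
by apply: filterS fg => x /= + Gx => ->.
Qed.

Lemma measurable_subcst {G f} (c : R) : measurable_fun G f ->
  measurable_fun G (fun x => f x - c).
Proof. by move=> mf; apply: measurable_funB. Qed.

Lemma oscillation_eq0P {G f} : measurable G -> measurable_fun G f ->
  oscillation mu p G f = 0%E <-> \forall x \ae mu, G x -> f x = mean mu G f.
Proof.
move=> mG mf.
have mo := measurable_normp (measurable_subcst (mean mu G f) mf).
have /(_ mo) := @ae_eq_integral_abs _ _ _ mu G mG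
  (fun x => (`|f x - mean mu G f| `^ p)%:E).
have -> : (\int[mu]_(x in G) `|(`|f x - mean mu G f| `^ p)%:E| =
    oscillation mu p G f)%E.
  by apply: eq_integral => x _; rewrite gee0_abs.
move=> ->; split; apply: filterS => x /= + Gx => /(_ Gx).
  move=> [] /eqP; rewrite powR_eq0 => /andP[/eqP/normr0_eq0/eqP].
  by rewrite subr_eq0 => /eqP.
by move=> ->; rewrite subrr normr0 powR0 // gt_eqF.
Qed.

(** Adding a constant moves the mean by the same amount, so functions minus
    their mean do not change. *)
Lemma oscillation_shift {G f g} {c : R} : finite_positive mu G ->
  measurable_fun G f -> measurable_fun G g -> mu.-integrable G (EFin \o f) ->
  (\forall x \ae mu, G x -> g x = f x + c) ->
  mean mu G g = mean mu G f + c /\ oscillation mu p G g = oscillation mu p G f.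
Proof.
move=> gG mf mg fi gf; have [mG _ _] := gG.
have mE : mean mu G g = mean mu G f + c.
  rewrite (@eq_mean _ _ (f \- cst (- c))) //.
  - by rewrite meanB ?mean_cst ?opprK//; exact: integrable_cst_finite_positive.
  - exact: measurable_funB.
  - by apply: filterS gf => x /= /[swap] Gx /(_ Gx) ->; rewrite opprK.
split; [exact: mE|apply: ge0_ae_eq_integral; first exact: mG].
- exact/measurable_normp/measurable_subcst.
- exact/measurable_normp/measurable_subcst.
- by move=> x _; rewrite lee_fin powR_ge0.
- by move=> x _; rewrite lee_fin powR_ge0.
- apply: filterS gf => x /= /[swap] Gx /(_ Gx) ->; rewrite mE.
  by congr (_ `^ _)%:E; congr `|_|; ring.
Qed.

(** A bound a on the L^p average gives a bound 2a on the L^1 average: integrate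
    [le_powR_affine] at a, where a^(1-p) a^p = a. *)
Lemma integral_norm_oscillation {G f} {a : R} : finite_positive mu G ->
  measurable_fun G f -> 0 < a -> (oscillation mu p G f <= (a `^ p)%:E * mu G)%E ->
  (\int[mu]_(x in G) `|f x - mean mu G f|%:E <= (2 * a)%:E * mu G)%E.
Proof.
move=> gG mf a0 fa; have [mG _ _] := gG; have [mE m0] := finite_positive_fine gG.
apply: le_trans (integral_norm_affine mG (measurable_subcst _ mf) a0) _.
rewrite -/(oscillation mu p G f).
apply: (@le_trans _ _ (a%:E * mu G + (a `^ (1 - p))%:E * ((a `^ p)%:E * mu G))%E).
  by apply: leeD2l; apply: lee_wpmul2l fa; rewrite lee_fin powR_ge0.
rewrite mE -!EFinM -EFinD lee_fin mulrA -powRD; last first.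
  by rewrite (gt_eqF a0) implybT.
rewrite subrK powRr1 ?(ltW a0) // le_eqVlt; apply/orP; left; apply/eqP; ring.
Qed.

End Averages.

(** * The BMO norm and the comparison of means along chains *)

Section BMONorm.
Context {R : realType} {d : measure_display} {T : measurableType d}.
Context {mu : {measure set T -> \bar R}} {p : R} {GG : set (set T)}.
Hypotheses (hp : 1 <= p) (hGG : generators mu GG).
Implicit Types (G : set T) (f g h : T -> R).

Let p_gt0 : 0 < p. Proof. exact: lt_le_trans ltr01 hp. Qed.

Lemma generator_finite_positive {G} : GG G -> finite_positive mu G.
Proof. by case: hGG => + _ => /[apply]. Qed.

Lemma bmo_normE f : bmo_norm mu p GG f = ereal_sup
  [set (((fine (mu G))^-1)%:E * oscillation mu p G f) `^ p^-1 | G in GG]%E.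
Proof. by []. Qed.

(** Removes the root and the division from the norm, so that bounds on the norm
    can be used and proved one generator at a time. *)
Lemma bmo_norm_leP {f} {a : R} : 0 <= a -> (bmo_norm mu p GG f <= a%:E)%E <->
  forall G, GG G -> (oscillation mu p G f <= (a `^ p)%:E * mu G)%E.
Proof.
move=> a0.
have osc0 G : (0 <= oscillation mu p G f)%E.
  by apply: integral_ge0 => x _; rewrite lee_fin powR_ge0.
have key G : GG G ->
  ((((fine (mu G))^-1)%:E * oscillation mu p G f) `^ p^-1 <= a%:E)%E =
  (oscillation mu p G f <= (a `^ p)%:E * mu G)%E.
  move=> /generator_finite_positive /finite_positive_fine[mE m0].
  rewrite [in RHS]mE [((a `^ p)%:E * _)%E]muleC -lee_pdivrMl //.
  have := osc0 G; move: (oscillation _ _ _ _) => o o0.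
  have v0 : (0 <= (fine (mu G))^-1%:E * o)%E.
    by rewrite mule_ge0 // lee_fin invr_ge0 ltW.
  move: ((_)%:E * o)%E v0 => v v0; apply/idP/idP => H.
  - have := @gt0_ler_poweR _ p (ltW p_gt0) (v `^ p^-1)%E a%:E.
    rewrite -poweRrM mulVf ?gt_eqF // poweRe1 // poweR_EFin; apply => //;
    by rewrite in_itv /= ?poweR_ge0 ?lee_fin ?a0 leey.
  - have := @gt0_ler_poweR _ p^-1 _ v (a `^ p)%:E.
    rewrite -poweR_EFin -poweRrM mulfV ?gt_eqF // poweRe1 ?lee_fin //; apply => //.
    + by rewrite invr_ge0 ltW.
    + by rewrite in_itv /= v0 leey.
    + by rewrite in_itv /= lee_fin powR_ge0 leey.
rewrite bmo_normE; split=> [H G GGG|H].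
  rewrite -key //; apply: le_trans H.
  by apply: ereal_sup_ubound; exists G.
by apply: ge_ereal_sup => _ [G GGG <-]; rewrite key //; exact: H.
Qed.

Lemma bmo_norm_ge0 {G} f : GG G -> (0 <= bmo_norm mu p GG f)%E.
Proof.
move=> GGG; apply: (@le_trans _ _
  ((((fine (mu G))^-1)%:E * oscillation mu p G f) `^ p^-1)%E).
  exact: poweR_ge0.
by rewrite bmo_normE; apply: ereal_sup_ubound; exists G.
Qed.

Lemma bmo_norm_ltyP {f} : (bmo_norm mu p GG f < +oo)%E <->
  exists2 a : R, 0 < a & (bmo_norm mu p GG f <= a%:E)%E.
Proof.
split=> [|[a _ /le_lt_trans]]; last by apply; exact: ltry.
case: (bmo_norm mu p GG f) => [r _||_] //.
  by exists (Num.max r 1); rewrite ?lt_max ?ltr01 ?orbT // lee_fin le_max lexx.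
by exists 1; rewrite ?leNye.
Qed.

Lemma bmo_norm_shift {f g} {c : R} :
  measurable_fun setT f -> measurable_fun setT g ->
  (forall G, GG G -> mu.-integrable G (EFin \o f)) ->
  (\forall x \ae mu, g x = f x + c) ->
  bmo_norm mu p GG g = bmo_norm mu p GG f.
Proof.
move=> mf mg fi gf.
have oE G : GG G -> oscillation mu p G g = oscillation mu p G f.
  move=> GGG; have mG := generator_finite_positive GGG.
  apply: (proj2 (oscillation_shift hp mG _ _ (fi _ GGG) _)).
  - exact: measurable_funTS.
  - exact: measurable_funTS.
  - by apply: filterS gf => x ->.
rewrite !bmo_normE; apply: (congr1 (@ereal_sup R)).
apply: eq_imagel => G GGG.
by rewrite oE.
Qed.

Lemma Lploc_integrable {f G} : Lploc mu p GG f -> GG G ->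
  mu.-integrable G (EFin \o f).
Proof.
move=> [mf fp] GGG; have [mG _ Goo] := generator_finite_positive GGG.
by apply: (Lp_integrable hp) => //; [exact: measurable_funTS | exact: fp].
Qed.

(** On the overlap, |c - c'| <= |h - c| + |h - c'| where c and c' are the two
    means of h.  Integrating, each term is controlled by the oscillation of h
    on one of the two generators. *)
Lemma mean_overlap {G G'} : GG G -> GG G' -> (0 < mu (G `&` G'))%E ->
  exists2 K : R, 0 <= K & forall h (a : R), measurable_fun setT h -> 0 < a ->
    (bmo_norm mu p GG h <= a%:E)%E ->
    `|mean mu G h - mean mu G' h| <= K * a.
Proof.
move=> GGG GGG' I0.
have gG := generator_finite_positive GGG; have gG' := generator_finite_positive GGG'.
have [mE m0] := finite_positive_fine gG; have [mE' m0'] := finite_positive_fine gG'.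
have [mG _ Goo] := gG; have [mG' _ _] := gG'.
have mI : measurable (G `&` G') by exact: measurableI.
have [IE i0] : mu (G `&` G') = (fine (mu (G `&` G')))%:E /\
    0 < fine (mu (G `&` G')).
  apply: finite_positive_fine; split=> //; apply: le_lt_trans Goo.
  by apply: le_measure; rewrite ?inE.
set m := fine (mu G) in mE m0 *; set m' := fine (mu G') in mE' m0' *.
set i := fine _ in IE i0.
exists (2 * (m + m') / i); first by rewrite divr_ge0 ?mulr_ge0 ?addr_ge0 ?ltW.
move=> h a mh a0 ha.
have bG := integral_norm_oscillation hp gG (measurable_funTS mh) a0
  ((bmo_norm_leP (ltW a0)).1 ha G GGG).
have bG' := integral_norm_oscillation hp gG' (measurable_funTS mh) a0
  ((bmo_norm_leP (ltW a0)).1 ha G' GGG').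
set c := mean mu G h in bG *; set c' := mean mu G' h in bG' *.
have mn (e : R) (D : set T) : measurable_fun D (fun x => `|h x - e|%:E).
  by apply: measurable_norm; apply: measurable_subcst; exact: measurable_funTS.
have : (`|c - c'|%:E * mu (G `&` G') <=
    (2 * a)%:E * mu G + (2 * a)%:E * mu G')%E.
  rewrite -integral_cst //.
  apply: (@le_trans _ _ (\int[mu]_(x in G `&` G')
      (`|h x - c|%:E + `|h x - c'|%:E))%E).
    apply: ge0_le_integral => //.
    - by move=> x _; rewrite lee_fin.
    - exact: emeasurable_funD.
    move=> x _; rewrite -EFinD lee_fin.
    have -> : c - c' = (h x - c') - (h x - c) by ring.
    by rewrite [leRHS]addrC; exact: ler_normB.
  rewrite ge0_integralD //; apply: leeD.
  - by apply: le_trans bG; apply: ge0_subset_integral.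
  - by apply: le_trans bG'; apply: ge0_subset_integral.
rewrite IE mE mE' -!EFinM -EFinD lee_fin => H.
rewrite mulrAC ler_pdivlMr //; apply: (le_trans H).
by rewrite le_eqVlt; apply/orP; left; apply/eqP; ring.
Qed.

Lemma mean_chain {G G'} : finite_chain_property mu GG -> GG G -> GG G' ->
  exists2 K : R, 0 <= K & forall h (a : R), measurable_fun setT h -> 0 < a ->
    (bmo_norm mu p GG h <= a%:E)%E ->
    `|mean mu G h - mean mu G' h| <= K * a.
Proof.
move=> fcp GGG GGG'; have [N [c [[cG cI] <- <-]]] := fcp _ _ GGG GGG'.
suff: forall n, (n <= N)%N -> exists2 K : R, 0 <= K &
    forall h (a : R), measurable_fun setT h -> 0 < a ->
    (bmo_norm mu p GG h <= a%:E)%E ->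
    `|mean mu (c 0%N) h - mean mu (c n) h| <= K * a by apply.
elim=> [_|n IH nN].
  by exists 0 => // h a _ _ _; rewrite subrr normr0 mul0r.
have [K K0 HK] := IH (ltnW nN).
have [|K' K'0 HK'] := mean_overlap (cG n (ltnW nN)) (cG n.+1 nN).
  by have := cI n.+1; rewrite nN; apply.
exists (K + K'); first exact: addr_ge0.
move=> h a mh a0 ha; rewrite mulrDl -(subrK (mean mu (c n) h) (mean mu (c 0%N) h)).
rewrite -addrA; apply: (le_trans (ler_normD _ _)).
by apply: lerD; [exact: HK | exact: HK'].
Qed.

(** A Poincare-type estimate: on G, h is within its oscillation of its mean on
    G, and a chain from G0 bounds this mean since h has mean 0 on G0.  The
    constant K depends on G but not on h. *)
Lemma norm_integral_le_bmo {G G0} : finite_chain_property mu GG ->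
  GG G0 -> GG G -> exists2 K : R, 0 <= K &
    forall h (a : R), measurable_fun setT h -> 0 < a ->
    mean mu G0 h = 0 -> (bmo_norm mu p GG h <= a%:E)%E ->
    (\int[mu]_(x in G) `|h x|%:E <= (K * a)%:E)%E.
Proof.
move=> fcp GGG0 GGG; have [K K0 HK] := mean_chain fcp GGG0 GGG.
have gG := generator_finite_positive GGG; have [mG _ _] := gG.
have [mE m0] := finite_positive_fine gG.
exists ((2 + K) * fine (mu G)); first by rewrite mulr_ge0 ?addr_ge0 // ltW.
move=> h a mh a0 h0 ha.
have := HK h a mh a0 ha; rewrite h0 sub0r normrN => hm.
have bG := integral_norm_oscillation hp gG (measurable_funTS mh) a0
  ((bmo_norm_leP (ltW a0)).1 ha G GGG).
set c := mean mu G h in bG hm.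
have mn (D : set T) : measurable_fun D (fun x => `|h x - c|%:E).
  by apply: measurable_norm; apply: measurable_subcst; exact: measurable_funTS.
apply: (@le_trans _ _ (\int[mu]_(x in G) (`|h x - c|%:E + (K * a)%:E))%E).
  apply: ge0_le_integral => //.
  - by apply: measurable_norm; exact: measurable_funTS.
  - exact: emeasurable_funD.
  - move=> x _; rewrite -EFinD lee_fin -{1}(subrK c (h x)).
    by apply: (le_trans (ler_normD _ _)); rewrite lerD2l.
rewrite ge0_integralD //; last first.
  by move=> x _; rewrite lee_fin mulr_ge0 // ltW.
rewrite integral_cst //; apply: (le_trans (leeD2r _ bG)).
rewrite mE -!EFinM -EFinD lee_fin.
by rewrite le_eqVlt; apply/orP; left; apply/eqP; ring.
Qed.

Lemma oscillationB {G f g} : GG G -> Lploc mu p GG f -> measurable_fun setT g ->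
  mu.-integrable G (EFin \o g) ->
  (oscillation mu p G (f \- g)%R <=
    (2 `^ p)%:E * (oscillation mu p G f + oscillation mu p G g))%E.
Proof.
move=> GGG fL mg gi; have [mG _ _] := generator_finite_positive GGG.
have fi := Lploc_integrable fL GGG; have [mf _] := fL.
have -> : oscillation mu p G g =
    (\int[mu]_(x in G) (`|- (g x - mean mu G g)| `^ p)%:E)%E.
  by apply: eq_integral => x _; rewrite normrN.
rewrite /oscillation meanB //.
have := @integral_normpD _ _ _ mu p hp G (fun x => f x - mean mu G f)
  (fun x => - (g x - mean mu G g)) mG.
have -> : (fun x => (`|(f \- g) x - (mean mu G f - mean mu G g)| `^ p)%:E) =
   (fun x => (`|f x - mean mu G f + - (g x - mean mu G g)| `^ p)%:E).
  by apply/funext => x /=; congr (_ `^ _)%:E; congr `|_|; ring.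
apply.
- by apply: measurable_subcst; exact: measurable_funTS.
- by apply: measurableT_comp => //; apply: measurable_subcst; exact: measurable_funTS.
Qed.

End BMONorm.

(** * Passing to the limit on one generator *)

(** The case l = 0 is separate because powers of negative numbers are 1 by
    convention, so that the power function is discontinuous at 0; it follows
    from u^p <= u for u in [0, 1]. *)
Lemma cvg_powR {R : realType} {p : R} {u : nat -> R} {l : R} : 1 <= p ->
  (forall k, 0 <= u k) -> u k @[k --> \oo] --> l ->
  u k `^ p @[k --> \oo] --> l `^ p.
Proof.
move=> hp u0 ul; have p0 : 0 < p by exact: lt_le_trans ltr01 hp.
have : 0 <= l by apply: (cvgr_to_ge ul); exact: nearW.
rewrite le_eqVlt => /predU1P[l0|l0]; last first.
  apply: (@continuous_cvg _ _ _ _ _ _ (fun y : R => y `^ p)); last exact: ul.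
  apply/differentiable_continuous/derivable1_diffP/derivable_powR.
  by rewrite in_itv /= l0.
rewrite -l0 powR0 ?gt_eqF //; rewrite -l0 in ul.
apply: (@squeeze_cvgr _ _ _ _ (fun=> 0) u) => //; last exact: cvg_cst.
near=> k; rewrite powR_ge0 /=.
have : u k <= 1 by near: k; exact: (cvgr_le _ ul).
have := u0 k; rewrite le_eqVlt => /predU1P[<- _|uk uk1].
  by rewrite powR0 ?gt_eqF.
by apply: ge1r_powR => //; rewrite uk.
Unshelve. all: by end_near. Qed.

Section Convergence.
Context {R : realType} {d : measure_display} {T : measurableType d}.
Context {mu : {measure set T -> \bar R}} {p : R}.
Implicit Types (G : set T) (f : T -> R) (F : nat -> T -> R).

(** The first half of the Riesz-Fischer argument in L^1: the sum of the absolute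
    increments is integrable, hence a.e. finite, which gives both pointwise
    convergence and, together with |F 0|, the dominating function g. *)
Lemma ae_cvg_of_summable_increments {G F} : measurable G ->
  (forall k, mu.-integrable G (EFin \o F k)) ->
  (\sum_(0 <= k <oo) \int[mu]_(x in G) `|F k.+1 x - F k x|%:E < +oo)%E ->
  exists2 g : T -> \bar R, mu.-integrable G g &
    \forall x \ae mu, G x ->
      cvgn (F^~ x) /\ forall n, (`|F n x|%:E <= g x)%E.
Proof.
move=> mG Fi sF; pose D k x := (`|F k.+1 x - F k x|%:E)%E.
have mF k : measurable_fun G (F k).
  by apply/measurable_EFinP; exact: measurable_int (Fi k).
have mD k : measurable_fun G (D k).
  by apply: measurable_norm; exact: measurable_funB.
have D0 k x : (0 <= D k x)%E by rewrite lee_fin.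
pose S x := (\sum_(0 <= k <oo) D k x)%E.
have S0 x : (0 <= S x)%E by exact: nneseries_ge0.
have Si : mu.-integrable G S.
  apply/integrableP; split; first exact: ge0_emeasurable_sum.
  have -> : (\int[mu]_(x in G) `|S x| = \int[mu]_(x in G) S x)%E.
    by apply: eq_integral => x _; rewrite gee0_abs.
  by rewrite integral_nneseries.
exists (fun x => (`|(EFin \o F 0%N) x| + S x)%E).
  by apply: integrableD => //; exact: integrable_abse.
apply: filterS (integrable_ae mG Si) => x + Gx => /(_ Gx) Sx.
have partial n : (\sum_(0 <= k < n) D k x <= S x)%E.
  by apply: nneseries_lim_ge.
split; last first.
  move=> n; apply: (@le_trans _ _ (`|F 0%N x|%:E + \sum_(0 <= k < n) D k x)%E);
    last by rewrite leeD2l.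
  elim: n => [|n IH]; first by rewrite big_geq // adde0.
  rewrite big_nat_recr //= addeA; apply: le_trans (leeD2r _ IH).
  rewrite -EFinD lee_fin addrC -{1}(subrK (F n x) (F n.+1 x)).
  exact: ler_normD.
have cS : cvgn (series (telescope (F^~ x))).
  (* The increments of the sequence are the terms of its telescoping series. *)
  have nE : [normed series (telescope (F^~ x))] =
      (fun n => \sum_(0 <= k < n) `|F k.+1 x - F k x|) by [].
  apply: normed_cvg; rewrite nE; apply: nondecreasing_is_cvgn.
    by apply/nondecreasing_seqP => n; rewrite big_nat_recr //= lerDl.
  exists (fine (S x)) => _ [n _ <-].
  by rewrite -lee_fin fineK // -sumEFin; exact: partial.
have -> : F^~ x = (fun n => series (telescope (F^~ x)) n + F 0%N x).
  by apply/funext => n; rewrite telescopeK subrK.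
exact: is_cvgD cS (is_cvg_cst _).
Qed.

(** Once the means converge, the integrands of the oscillations converge a.e.,
    and Fatou's lemma applies. *)
Lemma oscillation_fatou {G F f} {c : \bar R} : measurable G ->
  (forall k, measurable_fun G (F k)) -> measurable_fun G f ->
  mean mu G (F k) @[k --> \oo] --> mean mu G f ->
  (\forall x \ae mu, G x -> F k x @[k --> \oo] --> f x) ->
  (forall k, (oscillation mu p G (F k) <= c)%E) ->
  1 <= p ->
  (oscillation mu p G f <= c)%E.
Proof.
move=> mG mF mf mFf Ff Fc hp.
have p0 : 0 < p by exact: lt_le_trans ltr01 hp.
pose H k x := (`|F k x - mean mu G (F k)| `^ p)%:E.
have mH k : measurable_fun G (H k).
  exact/measurable_normp/measurable_subcst.
have mho : measurable_fun G (fun x => (`|f x - mean mu G f| `^ p)%:E).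
  exact/measurable_normp/measurable_subcst.
have -> : (oscillation mu p G f = \int[mu]_(x in G) limn_einf (H^~ x))%E.
  apply: ae_eq_integral => //.
    have -> : (fun x => limn_einf (H^~ x)) =
        (fun x => - limn_esup (fun k => - H k x))%E.
      apply/funext => x; rewrite -limn_einfN; congr limn_einf.
      by apply/funext => k; exact/esym/oppeK.
    apply: measurableT_comp => //; apply: measurable_fun_limn_esup => k.
    exact: measurableT_comp.
  apply: filterS Ff => x + Gx => /(_ Gx) Fx.
  apply/esym; apply: (cvg_limn_einf_sup _).1.
  apply: cvg_EFin; first by apply: nearW.
  apply: cvg_powR hp _ _; first by move=> k; exact: normr_ge0.
  by apply: cvg_norm; apply: cvgB.
apply: le_trans (fatou mu mG mH _) _.
  by move=> k x _; rewrite lee_fin powR_ge0.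
rewrite limn_einf_lim; apply: lime_le; first exact: is_cvg_einfs.
apply: nearW => n; apply: le_trans (Fc n).
by apply: ereal_inf_lbound; exists n => /=.
Qed.

Lemma cvg_mean {G F f} {g : T -> \bar R} : measurable G ->
  (forall k, measurable_fun G (F k)) -> measurable_fun G f ->
  mu.-integrable G g ->
  (\forall x \ae mu, G x -> F k x @[k --> \oo] --> f x /\
    forall n, (`|F n x|%:E <= g x)%E) ->
  mu.-integrable G (EFin \o f) /\
  mean mu G (F k) @[k --> \oo] --> mean mu G f.
Proof.
move=> mG mF mf gi Ff.
have [||||fi _ If] := @dominated_convergence _ _ _ mu G mG
  (fun k => EFin \o F k) (EFin \o f) g _ _ _ gi.
- by move=> k; exact/measurable_EFinP.
- exact/measurable_EFinP.
- apply: filterS Ff => x + Gx => /(_ Gx)[+ _] => Fx.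
  by apply: cvg_EFin; first exact: nearW.
- by apply: filterS Ff => x + n Gx => /(_ Gx)[_]; apply.
split=> //; apply: cvgMr.
apply: (@fine_cvg _ _ _ _ (fun k => \int[mu]_(x in G) (EFin \o F k) x)%E).
rewrite fineK //; exact: integrable_fin_num.
Qed.

End Convergence.

(** * Completeness *)

Section Completeness.
Context {R : realType} {d : measure_display} {T : measurableType d}.
Context {mu : {measure set T -> \bar R}} {p : R} {GG : set (set T)}.
Hypotheses (hp : 1 <= p) (hGG : generators mu GG).
Implicit Types (G : set T) (f g h : T -> R).

Let p_gt0 : 0 < p. Proof. exact: lt_le_trans ltr01 hp. Qed.

(** With h = f - g, write g = f - h; on each generator the p-th power of |h| is
    integrable because h is its mean plus a function of finite oscillation. *)
Lemma BMO_of_bmo_close {f g} : BMO mu p GG f -> measurable_fun setT g ->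
  (forall G, GG G -> mu.-integrable G (EFin \o g)) ->
  (bmo_norm mu p GG (f \- g)%R < +oo)%E -> BMO mu p GG g.
Proof.
move=> [fL /bmo_norm_ltyP[a a0 fa]] mg gi /bmo_norm_ltyP[b b0 hb].
have [mf fLp] := fL; pose h := f \- g.
have mh : measurable_fun setT h by exact: measurable_funB.
have osc_fin G (c : R) e : GG G ->
    (oscillation mu p G e <= c%:E * mu G)%E -> (oscillation mu p G e < +oo)%E.
  move=> /(generator_finite_positive hGG)/finite_positive_fine[-> _] /le_lt_trans; apply.
  by rewrite -EFinM ltry.
have hG G : GG G -> (oscillation mu p G h <= (b `^ p)%:E * mu G)%E.
  by move=> GGG; apply: (bmo_norm_leP hp hGG (ltW b0)).1.
have fG G : GG G -> (oscillation mu p G f <= (a `^ p)%:E * mu G)%E.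
  by move=> GGG; apply: (bmo_norm_leP hp hGG (ltW a0)).1.
have two0 : (0 <= (2 `^ p)%:E :> \bar R)%E by rewrite lee_fin powR_ge0.
split; first split => // G GGG.
  have [mG _ Goo] := generator_finite_positive hGG GGG.
  have mfG : measurable_fun G f by exact: measurable_funTS.
  have mhG : measurable_fun G h by exact: measurable_funTS.
  have hLp : (\int[mu]_(x in G) (`|- h x| `^ p)%:E < +oo)%E.
    have -> : (\int[mu]_(x in G) (`|- h x| `^ p)%:E =
        \int[mu]_(x in G) (`|(h x - mean mu G h) + mean mu G h| `^ p)%:E)%E.
      by apply: eq_integral => x _; rewrite normrN subrK.
    apply: (integral_normpD_lty hp (fun x => h x - mean mu G h)
      (cst (mean mu G h)) mG (measurable_subcst _ mhG)) => //.
      exact: osc_fin (hG _ GGG).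
    change (\int[mu]_(x in G) (`|mean mu G h| `^ p)%:E < +oo)%E.
    by rewrite integral_normp_cst // lte_mul_pinfty ?lee_fin ?powR_ge0.
  have -> : (\int[mu]_(x in G) (`|g x| `^ p)%:E =
      \int[mu]_(x in G) (`|f x + - h x| `^ p)%:E)%E.
    by apply: eq_integral => x _; rewrite /h /= opprB addrC subrK.
  apply: (integral_normpD_lty hp f (fun x => - h x) mG mfG) => //.
    exact: measurable_funN.
  exact: fLp.
pose M := 2 `^ p * (a `^ p + b `^ p).
have M0 : 0 < M by rewrite mulr_gt0 ?addr_gt0 ?powR_gt0.
apply/bmo_norm_ltyP; exists (M `^ p^-1); first exact: powR_gt0.
apply/(bmo_norm_leP hp hGG (powR_ge0 _ _)) => G GGG.
rewrite -powRrM mulVf ?gt_eqF // powRr1 ?(ltW M0) //.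
have -> : g = f \- h by apply/funext => x; rewrite /h /= opprB addrC subrK.
apply: (le_trans (oscillationB hp hGG GGG fL mh _)).
  have [mG _ _] := generator_finite_positive hGG GGG.
  have fi := Lploc_integrable hp hGG fL GGG.
  exact: (integrableB mG fi (gi _ GGG)).
rewrite EFinM -muleA; apply: lee_wpmul2l => //.
have [mE _] := finite_positive_fine (generator_finite_positive hGG GGG).
apply: (le_trans (leeD (fG _ GGG) (hG _ GGG))).
by rewrite mE -!EFinM -EFinD -mulrDl.
Qed.

Context {G0 : set T}.
Hypotheses (fcp : finite_chain_property mu GG) (GG0 : GG G0).

(** The same subsequence works for all generators, since its choice depends only
    on the norm; this is what makes the a.e. limits on the various generators
    restrictions of one function. *)
Lemma bmo_cauchy_cvg (F : nat -> T -> R) : (forall n, BMO mu p GG (F n)) ->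
  (forall n, mean mu G0 (F n) = 0) ->
  (forall e : R, 0 < e -> exists N, forall m n, (N <= m)%N -> (N <= n)%N ->
    (bmo_norm mu p GG (F m \- F n)%R < e%:E)%E) ->
  exists2 f, BMO mu p GG f & forall e : R, 0 < e -> exists N,
    forall n, (N <= n)%N -> (bmo_norm mu p GG (F n \- f)%R <= e%:E)%E.
Proof.
move=> FB F0 Fc.
have mF n : measurable_fun setT (F n) by case: (FB n) => -[].
have Fi n G : GG G -> mu.-integrable G (EFin \o F n).
  by move=> GGG; apply: (Lploc_integrable hp hGG) => //; case: (FB n).
pose a (k : nat) : R := 1 / (2 ^ k.+1)%:R.
have a0 k : 0 < a k by rewrite divr_gt0 // ltr0n expn_gt0.
have [N HN] := choice (fun k => Fc (a k) (a0 k)).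
(* The summand k makes s k at least k, so that every tail of the sequence F
   contains all but finitely many F (s k). *)
pose s k := (\sum_(i < k.+1) N i + k)%N.
have leNs k : (N k <= s k)%N by rewrite /s big_ord_recr /= -addnA addnCA leq_addr.
have leNsS k : (N k <= s k.+1)%N.
  by rewrite /s !big_ord_recr /= -!addnA addnCA leq_addr.
have leks k : (k <= s k)%N by rewrite leq_addl.
pose E k := F (s k).
have Eincr k : (bmo_norm mu p GG (E k.+1 \- E k)%R <= (a k)%:E)%E.
  by apply/ltW/HN.
(* Measurable on the whole space; where E converges, it is the limit. *)
pose f x := fine (limn_esup (fun k => (E k x)%:E)).
have mf : measurable_fun setT f.
  apply: (measurableT_comp (fine_measurable measurableT)).
  by apply: measurable_fun_limn_esup => k; apply/measurable_EFinP; exact: mF.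
have fE x : cvgn (E^~ x) -> E k x @[k --> \oo] --> f x.
  move=> /cvg_ex[l El]; suff -> : f x = l by [].
  rewrite /f (cvg_limn_einf_sup (_ : _ --> l%:E)).2 //.
  by apply: cvg_EFin => //; exact: nearW.
have conv G : GG G -> [/\ mu.-integrable G (EFin \o f),
    mean mu G (E k) @[k --> \oo] --> mean mu G f &
    \forall x \ae mu, G x -> E k x @[k --> \oo] --> f x].
  move=> GGG; have [mG _ _] := generator_finite_positive hGG GGG.
  have [K K0 HK] := norm_integral_le_bmo hp hGG fcp GG0 GGG.
  have [||g gi Eg] := @ae_cvg_of_summable_increments _ _ _ mu G E mG.
  - by move=> k; exact: Fi.
  - apply: (@le_lt_trans _ _ K%:E); last exact: ltry.
    apply: le_trans (epsilon_trick0 xpredT K0).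
    apply: lee_nneseries => k _; first by move=> _; exact: integral_ge0.
    have -> : K / (2 ^ k.+1)%:R = K * a k by rewrite /a div1r.
    apply: (HK (E k.+1 \- E k)) => //; first by apply: measurable_funB; exact: mF.
    by rewrite (meanB _ (Fi _ _ GG0) (Fi _ _ GG0)) ?F0 ?subrr //;
      case: (generator_finite_positive hGG GG0).
  have Eg' : \forall x \ae mu, G x -> E k x @[k --> \oo] --> f x /\
      forall n, (`|E n x|%:E <= g x)%E.
    by apply: filterS Eg => x + Gx => /(_ Gx)[/fE].
  have [||fi Ef] := @cvg_mean _ _ _ mu G E f g mG _ _ gi Eg'.
  - by move=> k; apply: measurable_funTS; exact: mF.
  - exact: measurable_funTS.
  by split => //; apply: filterS Eg' => x + Gx => /(_ Gx)[].
have tail e : 0 < e -> exists N, forall n, (N <= n)%N ->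
    (bmo_norm mu p GG (F n \- f)%R <= e%:E)%E.
  move=> e0; have [N0 HN0] := Fc e e0; exists N0 => n N0n.
  apply/(bmo_norm_leP hp hGG (ltW e0)) => G GGG.
  have [fi Emean Ef] := conv G GGG.
  have [mG _ _] := generator_finite_positive hGG GGG.
  apply: (@oscillation_fatou _ _ _ mu p G (fun k => F n \- E (k + N0)%N)) => //.
  - by move=> k; apply: measurable_funTS; apply: measurable_funB; exact: mF.
  - by apply: measurable_funTS; apply: measurable_funB => //; exact: mF.
  - rewrite (meanB mG (Fi _ _ GGG) fi).
    under eq_fun do rewrite (meanB mG (Fi _ _ GGG) (Fi _ _ GGG)).
    apply: cvgB; first exact: cvg_cst.
    by rewrite (cvg_shiftn N0 (fun k => mean mu G (E k))).
  - apply: filterS Ef => x + Gx => /(_ Gx) Ex.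
    apply: cvgB; first exact: cvg_cst.
    by rewrite (cvg_shiftn N0 (E^~ x)).
  - move=> k; apply: (bmo_norm_leP hp hGG (ltW e0)).1 => //.
    apply/ltW/HN0 => //; apply: leq_trans (leks _); exact: leq_addl.
exists f => //.
have [N1 HN1] := tail 1 ltr01.
apply: (BMO_of_bmo_close (FB N1) mf).
  by move=> G /conv[].
by apply: le_lt_trans (HN1 _ (leqnn _)) _; exact: ltry.
Qed.

End Completeness.

(** * Essential unions in a decomposable space *)

Section EssentialUnion.
Context {R : realType} {d : measure_display} {T : measurableType d}.
Context {mu : {measure set T -> \bar R}}.
Implicit Types (C : set (set T)) (Y A G : set T).

Lemma bigcup_enum {C} : countable C ->
  exists (e : nat -> set T) (P : set nat), (forall n, P n -> C (e n)) /\
    \bigcup_(G in C) G = \bigcup_(n in P) e n.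
Proof.
move=> cC; have [e Ce] := pcard_surjP (cC : (C #<= [set: nat])%card).
exists e, (e @^-1` C); split=> //; apply/seteqP; split=> x.
  by move=> [G CG Gx]; have [n _ en] := Ce _ CG; exists n; rewrite /= en.
by move=> [n /= Cn enx]; exists (e n).
Qed.

Lemma measure0_bigcup {E : set T} {e : nat -> set T} {P : set nat} :
  measurable E -> (forall n, P n -> measurable (e n)) ->
  (forall n, P n -> mu (E `&` e n) = 0%E) ->
  mu (E `&` \bigcup_(n in P) e n) = 0%E.
Proof.
move=> mE me Ee; apply: (negligibleP mu _).1.
  by apply: measurableI => //; exact: bigcup_measurable.
have -> : E `&` \bigcup_(n in P) e n =
    \bigcup_n (if n \in P then E `&` e n else set0).
  rewrite setI_bigcupr bigcup_mkcond //.
apply: negligible_bigcup => n; case: ifPn => [/set_mem Pn|_].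
  by apply/negligibleP; [exact: measurableI (me _ _)|exact: Ee].
exact: negligible_set0.
Qed.

(** Exhaustion: choose sequences in C whose unions meet Y in measure closer and
    closer to the supremum, and merge them into one sequence, which attains it.
    Adding any G of C to that sequence cannot increase the measure, so G adds
    only a null set inside Y. *)
Lemma essential_union_finite {C Y} : C !=set0 ->
  (forall G, C G -> measurable G) -> measurable Y -> (mu Y < +oo)%E ->
  exists2 e : nat -> set T, (forall n, C (e n)) &
    forall G, C G -> mu ((G `&` Y) `\` \bigcup_n e n) = 0%E.
Proof.
move=> [C0 CC0] mC mY Yoo.
pose V (e : nat -> set T) := mu (Y `&` \bigcup_n e n).
pose s := ereal_sup [set V e | e in [set e | forall n, C (e n)]].
have mU (e : nat -> set T) : (forall n, C (e n)) -> measurable (Y `&` \bigcup_n e n).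
  by move=> Ce; apply: measurableI => //; apply: bigcup_measurable => n _;
    exact: mC.
have Vs (e : nat -> set T) : (forall n, C (e n)) -> (V e <= s)%E.
  by move=> Ce; apply: ereal_sup_ubound; exists e.
have VY (e : nat -> set T) : (forall n, C (e n)) -> (V e <= mu Y)%E.
  by move=> Ce; apply: le_measure; rewrite ?inE //; exact: mU.
have Vfin (e : nat -> set T) : (forall n, C (e n)) -> V e \is a fin_num.
  by move=> Ce; rewrite ge0_fin_numE // (le_lt_trans (VY e Ce)).
have sfin : s \is a fin_num.
  rewrite ge0_fin_numE; last by apply: le_trans (Vs (fun=> C0) _).
  by apply: le_lt_trans Yoo; apply: ge_ereal_sup => _ [e Ce <-]; exact: VY.
have near_sup k : exists e : nat -> set T, (forall n, C (e n)) /\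
    (s - (k.+1%:R^-1)%:E < V e)%E.
  have k0 : 0 < k.+1%:R^-1 :> R by rewrite invr_gt0.
  by have [_ [e Ce <-] ?] := ub_ereal_sup_adherent k0 sfin; exists e.
have [E HE] := choice near_sup.
(* C0 only fills the indices which code no pair. *)
pose e n := if unpickle n is Some kj then E kj.1 kj.2 else C0.
have Ce n : C (e n).
  by rewrite /e; case: unpickle => [[k j]|] //; exact: (HE k).1.
have EV k : (V (E k) <= V e)%E.
  apply: le_measure; rewrite ?inE; try exact: mU.
    by apply: mU => n; exact: (HE k).1.
  apply: setIS => x [j _ Ex]; exists (pickle (k, j)) => //.
  by rewrite /e pickleK.
have sV : (s <= V e)%E.
  rewrite leNgt; apply/negP => sV.
  have := sV; rewrite -(fineK sfin) -(fineK (Vfin e Ce)) lte_fin.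
  move=> /ltr_add_invr[k]; rewrite ltNge => /negP; apply.
  rewrite -lee_fin EFinD !fineK ?Vfin // -leeBlDr //.
  by apply/ltW/(lt_le_trans (HE k).2).
exists e => // G CG.
(* G followed by the optimal sequence, a competitor for the supremum. *)
pose e' n := if n is m.+1 then e m else G.
have Ce' n : C (e' n) by case: n.
have mG := mC _ CG.
have mA : measurable (\bigcup_n e n).
  by apply: bigcup_measurable => n _; exact: mC.
have : (V e + mu ((G `&` Y) `\` \bigcup_n e n) <= V e + 0)%E.
  rewrite adde0; apply: le_trans sV; apply: le_trans (Vs e' Ce').
  rewrite /V -measureU.
  - apply: le_measure; rewrite ?inE.
    + apply: measurableU; first exact: mU.
      by apply: measurableD => //; exact: measurableI.
    + exact: mU.
    + move=> x [[Yx [n _ en]]|[[Gx Yx] _]]; split => //; first by exists n.+1.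
      by exists 0%N.
  - exact: mU.
  - by apply: measurableD => //; exact: measurableI.
  - by apply/seteqP; split=> // x [[_ ?] [_]].
rewrite leeD2lE ?Vfin // => le0.
by apply/eqP; rewrite eq_le le0 measure_ge0.
Qed.

Lemma decomposition_null {Omega : choiceType} {X : Omega -> set T} {E} :
  decomposition mu X -> measurable E -> (forall w, mu (E `&` X w) = 0%E) ->
  mu E = 0%E.
Proof. by move=> [_ _ _ _ muE] mE E0; rewrite muE // esum1. Qed.

(** A is glued from the unions obtained on the pieces.  This works although
    there may be uncountably many pieces, because measurability and nullity
    are both detected piecewise.  The last two clauses express that, up to null
    sets, A is the least measurable set containing the members of C. *)
Lemma essential_union {Omega : choiceType} {X : Omega -> set T} {C} :
  decomposition mu X -> C !=set0 -> (forall G, C G -> measurable G) ->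
  exists (A : set T) (e : Omega -> nat -> set T),
    [/\ measurable A, (forall w n, C (e w n)) /\
          (forall w, A `&` X w = X w `&` \bigcup_n e w n),
        forall G, C G -> mu (G `\` A) = 0%E &
        forall E, measurable E -> (forall G, C G -> mu (E `&` G) = 0%E) ->
          mu (E `&` A) = 0%E].
Proof.
move=> DX Cne mC; have [[_ trX covX] mX Xoo XA muX] := DX.
have [e He] := choice (fun w =>
  let: ex_intro2 e H1 H2 := essential_union_finite Cne mC (mX w) (Xoo w) in
  ex_intro _ e (conj H1 H2)).
pose A := \bigcup_w (X w `&` \bigcup_n e w n).
have AX w : A `&` X w = X w `&` \bigcup_n e w n.
  apply/seteqP; split=> x.
    move=> [[v _ [Xv ev]] Xw]; suff -> : w = v by [].
    by apply: (trX w v) => //; exists x.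
  by move=> [Xw ew]; split=> //; exists w.
have mU w : measurable (\bigcup_n e w n).
  by apply: bigcup_measurable => n _; apply: mC; exact: (He w).1.
have mA : measurable A.
  by apply: XA => w; rewrite AX; exact: measurableI.
exists A, e; split=> //.
- by split=> // w; exact: (He w).1.
- move=> G CG; have mG := mC _ CG.
  apply: (decomposition_null DX); first exact: measurableD.
  move=> w; rewrite -((He w).2 _ CG); congr (mu _).
  have : forall x, X w x -> A x <-> (\bigcup_n e w n) x.
    move=> x Xx; have := AX w; move/seteqP => [AX1 AX2].
    by split=> [Ax|ex]; [have [] := AX1 x (conj Ax Xx)
                        |have [] := AX2 x (conj Xx ex)].
  move=> H; apply/seteqP; split=> x.
    by move=> [[Gx Ax] Xx]; split=> // /(H _ Xx).
  by move=> [[Gx Xx] ex]; split=> //; split=> // /(H _ Xx).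
- move=> E mE EC.
  apply: (decomposition_null DX); first exact: measurableI.
  move=> w; rewrite -setIA AX setIA.
  have mEX : measurable (E `&` X w) := measurableI _ _ mE (mX w).
  apply: (measure0_bigcup mEX).
    by move=> n _; apply: mC; exact: (He w).1.
  move=> n _; have men : measurable (e w n) by apply: mC; exact: (He w).1.
  apply: (subset_measure0 (B := E `&` e w n)).
  + exact: measurableI.
  + exact: measurableI.
  + by move=> x [[]].
  + by apply: EC; exact: (He w).1.
Qed.

End EssentialUnion.

(** * The implications between the three properties *)

Section Equivalence.
Context {R : realType} {d : measure_display} {T : measurableType d}.
Context {mu : {measure set T -> \bar R}} {p : R} {GG : set (set T)}.
Hypotheses (hp : 1 <= p) (hGG : generators mu GG).
Implicit Types (G : set T) (f g h : T -> R).

Let p_gt0 : 0 < p. Proof. exact: lt_le_trans ltr01 hp. Qed.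

Lemma generators_nonempty : GG !=set0.
Proof.
have [_ cov] := hGG; have : [set: T] point by [].
by rewrite -cov => -[G GGG _]; exists G.
Qed.

Lemma bmo_norm_eq0P {f} : measurable_fun setT f ->
  bmo_norm mu p GG f = 0%E <->
  forall G, GG G -> \forall x \ae mu, G x -> f x = mean mu G f.
Proof.
move=> mf.
have mfG G : measurable_fun G f by exact: measurable_funTS.
have osc0 G : (0 <= oscillation mu p G f)%E.
  by apply: integral_ge0 => x _; rewrite lee_fin powR_ge0.
split=> [f0 G GGG|fG].
  have [mG _ _] := generator_finite_positive hGG GGG.
  apply/(oscillation_eq0P hp mG (mfG G)).
  apply/eqP; rewrite eq_le osc0 andbT.
  have := (@bmo_norm_leP _ _ _ mu p GG hp hGG f 0 (lexx _)).1.
  rewrite f0 => /(_ (lexx _) _ GGG).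
  by rewrite powR0 ?gt_eqF // mul0e.
have [G1 GG1] := generators_nonempty.
apply/eqP; rewrite eq_le (bmo_norm_ge0 f GG1) andbT.
apply/(bmo_norm_leP hp hGG (lexx _)) => G GGG.
have [mG _ _] := generator_finite_positive hGG GGG.
rewrite (oscillation_eq0P hp mG (mfG G)).2; last exact: fG.
by rewrite mule_ge0 // lee_fin powR_ge0.
Qed.

Lemma locally_constant_bmo {f} : measurable_fun setT f ->
  (forall G, GG G -> exists c, \forall x \ae mu, G x -> f x = c) ->
  BMO mu p GG f /\ bmo_norm mu p GG f = 0%E.
Proof.
move=> mf fc.
have f0 : bmo_norm mu p GG f = 0%E.
  apply/(bmo_norm_eq0P mf) => G GGG; have [c fGc] := fc G GGG.
  have gG := generator_finite_positive hGG GGG; have [mG _ _] := gG.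
  suff -> : mean mu G f = c by [].
  rewrite -[RHS](mean_cst c gG); apply: eq_mean => //.
  exact: measurable_funTS.
split=> //; split; last by rewrite f0.
split=> // G GGG; have [c fGc] := fc G GGG.
have [mG _ Goo] := generator_finite_positive hGG GGG.
have -> : (\int[mu]_(x in G) (`|f x| `^ p)%:E =
    \int[mu]_(x in G) (`|c| `^ p)%:E)%E.
  apply: ge0_ae_eq_integral => //.
  - by apply: measurable_normp; exact: measurable_funTS.
  - by apply: filterS fGc => x + Gx => /(_ Gx) ->.
by rewrite integral_normp_cst // lte_mul_pinfty ?lee_fin ?powR_ge0.
Qed.

(** The indicator of such an A is a.e. constant on each generator, so it has
    norm 0 and must be a.e. 0 or a.e. 1. *)
Lemma norm_modulo_constants_dichotomy {A : set T} :
  norm_modulo_constants mu p GG -> measurable A ->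
  (forall G, GG G -> mu (G `\` A) = 0%E \/ mu (G `&` A) = 0%E) ->
  mu A = 0%E \/ mu (~` A) = 0%E.
Proof.
move=> normc mA GA.
have m1A : measurable_fun setT (\1_A : T -> R) by exact: measurable_indic.
have in1 x : A x -> \1_A x = 1 :> R by move=> Ax; rewrite indicE mem_set.
have in0 x : ~ A x -> \1_A x = 0 :> R by move=> Ax; rewrite indicE memNset.
have [|B B0] := @locally_constant_bmo (\1_A) m1A.
  move=> G GGG; have [mG _ _] := generator_finite_positive hGG GGG.
  have [G0|G0] := GA G GGG; [exists 1|exists 0].
  - exists (G `\` A); split=> //; first exact: measurableD.
    move=> x /= /not_implyP[Gx Ax]; split=> // Ax'.
    by apply: Ax; exact: in1.
  - exists (G `&` A); split=> //; first exact: measurableI.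
    move=> x /= /not_implyP[Gx Ax]; split=> //.
    by apply: contrapT => /in0.
have [c] := normc _ B B0.
have [-> Ac|c1 Ac] := eqVneq c 1.
  right; apply: (negligibleP mu (measurableC mA)).1.
  apply: negligibleS Ac => x /= /in0 -> /esym/eqP.
  by rewrite oner_eq0.
left; apply: (negligibleP mu mA).1.
by apply: negligibleS Ac => x /= /in1 -> /esym/eqP; rewrite (negPf c1).
Qed.

Definition chained (G G' : set T) : Prop :=
  exists N c, [/\ finite_chain mu GG N c, c 0%N = G & c N = G'].

Lemma chained_refl {G} : GG G -> chained G G.
Proof.
move=> GGG; exists 0%N, (fun=> G); split=> //; split=> // n.
by case: n.
Qed.

Lemma chained_step {G G1 G2} : chained G G1 -> GG G2 ->
  (0 < mu (G1 `&` G2))%E -> chained G G2.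
Proof.
move=> [N [c [[cG cI] c0 cN]]] GG2 I0.
exists N.+1, (fun n => if (n <= N)%N then c n else G2); split.
- split=> n.
    by move=> _; case: ifP => [/cG|].
  case: n => // n /andP[_]; rewrite ltnS => nN /=.
  rewrite nN; case: ifPn => [nN'|]; first exact: (cI n.+1).
  rewrite -leqNgt => Nn.
  by have -> : n = N; [apply/eqP; rewrite eqn_leq nN | rewrite cN].
- by rewrite leq0n.
- by rewrite ltnn.
Qed.

(** If G and G' are not chained, the essential union of the generators chained
    to G contains G and misses G', against the dichotomy.  Every generator is
    either in this class or meets all its members in null sets, as otherwise a
    chain could be extended to it. *)
Lemma norm_modulo_constants_chain : decomposable mu ->
  norm_modulo_constants mu p GG -> finite_chain_property mu GG.
Proof.
move=> [I [X DX]] normc G G' GGG GGG'; apply: contrapT => nch.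
pose C := [set G1 | GG G1 /\ chained G G1].
have CG : C G by split=> //; exact: chained_refl.
have mGG G1 : GG G1 -> measurable G1 by move=> /(generator_finite_positive hGG)[].
have mC G1 : C G1 -> measurable G1 by move=> [/mGG].
have [A [e [mA _ CA CE]]] := essential_union DX (ex_intro _ _ CG) mC.
have GA G1 : GG G1 -> ~ chained G G1 -> mu (G1 `&` A) = 0%E.
  move=> GG1 nch1; apply: CE; first exact: mGG.
  move=> G2 [GG2 ch2]; apply: contrapT => /eqP I0; apply: nch1.
  apply: (chained_step ch2 GG1).
  by rewrite setIC lt0e I0 measure_ge0.
have split0 G1 : GG G1 -> mu (G1 `\` A) = 0%E -> mu (G1 `&` A) = 0%E -> False.
  move=> GG1 D0 I0; have [mG1 G10 _] := generator_finite_positive hGG GG1.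
  have GE : mu G1 = (mu (G1 `\` A) + mu (G1 `&` A))%E := measureDI mu mG1 mA.
  by move: G10; rewrite GE D0 I0 adde0 ltxx.
have [|A0|A0] := norm_modulo_constants_dichotomy normc mA.
- move=> G1 GG1; have [ch1|/GA] := pselect (chained G G1).
    by left; apply: CA.
  by move=> /(_ GG1); right.
- apply: (split0 G GGG (CA _ CG)).
  by apply: (subset_measure0 (B := A)) => //; apply: measurableI => //; exact: mGG.
- apply: (split0 G' GGG' _ (GA _ GGG' nch)).
  apply: (subset_measure0 (B := ~` A) _ _ _ A0); last by move=> x [].
    by apply: measurableD => //; exact: mGG.
  exact: measurableC.
Qed.

(** The essential union of all generators has full measure by the dichotomy, so
    the countable families used on the pieces cover them up to null sets. *)
Lemma norm_modulo_constants_sigma_decomposable : decomposable mu ->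
  norm_modulo_constants mu p GG -> sigma_decomposable mu GG.
Proof.
move=> [I [X DX]] normc; exists I, X; split=> // w.
have mGG G : GG G -> measurable G by move=> /(generator_finite_positive hGG)[].
have [A [e [mA [eG AX] GA _]]] := essential_union DX generators_nonempty mGG.
exists (range (e w)); split.
- exact: (sub_countable (card_image_le _ _)).
- by move=> _ [n _ <-]; exact: eG.
- have [_ mX _ _ _] := DX.
  have me : measurable (\bigcup_n e w n).
    by apply: bigcup_measurable => n _; apply: mGG; exact: eG.
  rewrite bigcup_image.
  have [|A0|A0] := norm_modulo_constants_dichotomy normc mA.
  + by move=> G GGG; left; exact: GA.
  + have [G GGG] := generators_nonempty.
    have [mG G0 _] := generator_finite_positive hGG GGG.
    have GE : mu G = (mu (G `\` A) + mu (G `&` A))%E := measureDI mu mG mA.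
    move: G0; rewrite GE GA // add0e.
    rewrite (subset_measure0 (B := A)) ?ltxx //; first exact: measurableI.
  + apply: (subset_measure0 (B := ~` A)) => //.
    * exact: measurableD.
    * exact: measurableC.
    * move=> x [Xx ex] Ax; apply: ex.
      by have /seteqP[/(_ x (conj Ax Xx))[]] := AX w.
Qed.

Lemma chain_sigma_norm_modulo_constants :
  finite_chain_property mu GG -> sigma_decomposable mu GG ->
  norm_modulo_constants mu p GG.
Proof.
move=> fcp [I [X [DX sX]]] f [[mf _] _] f0.
have [G0 GG0] := generators_nonempty.
have meanE G : GG G -> mean mu G f = mean mu G0 f.
  move=> GGG; have [K K0 HK] := mean_chain hp hGG fcp GG0 GGG.
  apply/esym/eqP; rewrite -subr_eq0 -normr_le0; apply/ler_addgt0Pl => e e0.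
  rewrite addr0; have K1 : 0 < K + 1 by rewrite ltr_wpDl.
  have a0 : 0 < e / (K + 1) by rewrite divr_gt0.
  apply: (le_trans (HK f _ mf a0 _)); first by rewrite f0 lee_fin ltW.
  by rewrite mulrCA ler_piMr ?ltW // ltr_pdivrMr // mul1r ltrDl.
pose c := mean mu G0 f; exists c.
pose N := [set x | f x <> c].
have mN : measurable N.
  have -> : N = f @^-1` (~` [set c]) by [].
  rewrite -[X in measurable X]setTI; apply: mf => //.
  exact: measurableC.
suff N0 : mu N = 0%E by exists N; split.
apply: (decomposition_null DX mN) => w.
have [_ mX _ _ _] := DX.
have [Gw [cGw GwGG Gw0]] := sX w.
have [e [P [PC UE]]] := bigcup_enum cGw.
have me n : P n -> measurable (e n).
  by move=> /PC/GwGG/(generator_finite_positive hGG)[].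
have mU : measurable (\bigcup_(n in P) e n) by exact: bigcup_measurable.
have NU : mu (N `&` \bigcup_(n in P) e n) = 0%E.
  apply: (measure0_bigcup mN me) => n Pn.
  have GGe := GwGG _ (PC _ Pn).
  apply: (negligibleP mu (measurableI _ _ mN (me _ Pn))).1.
  have := (bmo_norm_eq0P mf).1 f0 _ GGe.
  apply: negligibleS => x /= [Nx ex] /(_ ex).
  by rewrite meanE.
apply: (negligibleP mu (measurableI _ _ mN (mX w))).1.
have XU : mu.-negligible (X w `\` \bigcup_(n in P) e n).
  by apply/negligibleP; [exact: measurableD|rewrite -UE].
have NU' : mu.-negligible (N `&` \bigcup_(n in P) e n).
  by apply/negligibleP => //; exact: measurableI.
apply: negligibleS (negligibleU XU NU') => x [Nx Xx].
have [ex|ex] := pselect ((\bigcup_(n in P) e n) x); first by right.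
by left.
Qed.

(** Each coset has a representative with mean 0 on G0.  Members of a coset
    differ from it by an a.e. constant, so the quotient norm of a difference of
    cosets is the norm of the difference of representatives, and the statement
    reduces to the convergence of a normalized Cauchy sequence. *)
Lemma chain_quotient_complete : finite_chain_property mu GG ->
  quotient_complete mu p GG.
Proof.
move=> fcp u uQ uC.
have [G0 GG0] := generators_nonempty; have gG0 := generator_finite_positive hGG GG0.
have [mG0 _ _] := gG0.
have BMO_m f : BMO mu p GG f -> measurable_fun setT f by case=> -[].
have BMO_i f G : BMO mu p GG f -> GG G -> mu.-integrable G (EFin \o f).
  by move=> [fL _] GGG; exact: (Lploc_integrable hp hGG fL).
have rep n : exists F : T -> R, [/\ BMO mu p GG F, mean mu G0 F = 0,
    u n F & forall g, u n g -> BMO mu p GG g /\ ae_constant mu (g \- F)].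
  have [f fB <-] := uQ n; pose c := mean mu G0 f.
  pose F := f \- cst c.
  have mF : measurable_fun setT F by apply: measurable_funB => //; exact: BMO_m.
  have cE : f \- F = cst c by apply/funext => x; rewrite /F /= opprB addrC subrK.
  have [cB c0] : BMO mu p GG (cst c) /\ bmo_norm mu p GG (cst c) = 0%E.
    apply: locally_constant_bmo => // G _; exists c.
    by apply: nearW.
  have FB : BMO mu p GG F.
    apply: (BMO_of_bmo_close hp hGG fB mF); last by rewrite cE c0.
    move=> G GGG; have [mG _ _] := generator_finite_positive hGG GGG.
    exact: (integrableB mG (BMO_i _ _ fB GGG) (BMO_i _ _ cB GGG)).
  exists F; split; first exact: FB.
  - rewrite /F (meanB mG0 (BMO_i _ _ fB GG0) (BMO_i _ _ cB GG0)).
    by rewrite mean_cst // subrr.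
  - split; first exact: FB.
    exists (- c); apply: nearW => x.
    by rewrite /F /= addrAC subrr add0r.
  - move=> g [gB [k gk]]; split=> //; exists (k + c).
    by apply: filterS gk => x; rewrite /F /= => <-; ring.
have [F HF] := choice rep.
have FB n : BMO mu p GG (F n) by case: (HF n).
have [||f fB Ff] := bmo_cauchy_cvg hp hGG fcp GG0 _ FB.
- by move=> n; case: (HF n).
- move=> e e0; have [N HN] := uC e e0; exists N => m n Nm Nn.
  have /ereal_inf_lt[_ [_ [g ug [h uh <-]] <-]] := HN m n Nm Nn.
  have [_ _ _ Hm] := HF m; have [_ _ _ Hn] := HF n.
  have [gB [k gk]] := Hm g ug; have [hB [l hl]] := Hn h uh.
  suff -> : bmo_norm mu p GG (g \- h) = bmo_norm mu p GG (F m \- F n) by [].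
  apply: (bmo_norm_shift (c := k - l) hp hGG).
  + exact: (measurable_funB (BMO_m _ (FB m)) (BMO_m _ (FB n))).
  + exact: (measurable_funB (BMO_m _ gB) (BMO_m _ hB)).
  + move=> G GGG; have [mG _ _] := generator_finite_positive hGG GGG.
    exact: (integrableB mG (BMO_i _ _ (FB m) GGG) (BMO_i _ _ (FB n) GGG)).
  + by apply: filterS2 gk hl => x /= <- <-; ring.
exists (bmo_coset mu p GG f); first by exists f.
have qn n : (0 <= quotient_norm mu p GG (coset_sub (u n) (bmo_coset mu p GG f))
    <= bmo_norm mu p GG (F n \- f)%R)%E.
  apply/andP; split.
    by apply: le_ereal_inf_tmp => _ [g _ <-]; exact: bmo_norm_ge0 GG0.
  apply: ereal_inf_lbound; exists (F n \- f) => //.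
  exists (F n); first by case: (HF n).
  exists f => //; split=> //; exists 0.
  by apply: nearW => x /=; rewrite subrr.
apply: (@squeeze_cvge _ _ _ _ (fun=> 0%E) _
  (fun n => bmo_norm mu p GG (F n \- f)%R)).
- by apply: nearW => n; exact: qn.
- exact: cvg_cst.
- apply/fine_cvgP; split.
    have [N HN] := Ff 1 ltr01; exists N => // n /= Nn.
    rewrite ge0_fin_numE; last exact: bmo_norm_ge0 GG0.
    by apply: (le_lt_trans (HN n Nn)); exact: ltry.
  apply/cvgr0Pnorm_le => e e0; have [N HN] := Ff e e0; exists N => // n /= Nn.
  have b0 := bmo_norm_ge0 (mu := mu) (p := p) (F n \- f) GG0.
  rewrite ger0_norm ?fine_ge0 // -lee_fin fineK ?HN //.
  rewrite ge0_fin_numE //.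
  by apply: (le_lt_trans (HN n Nn)); exact: ltry.
Qed.

End Equivalence.

Theorem theorem1p1 (R : realType) (d : measure_display) (T : measurableType d)
    (mu : {measure set T -> \bar R}) (GG : set (set T)) (p : R)
    (hp : 1 <= p)
    (mu_nontrivial : nontrivial_measure mu)
    (mu_semifinite : semifinite mu)
    (mu_complete : measure_is_complete mu)
    (mu_decomposable : decomposable mu)
    (hGG : generators mu GG) :
  [<-> finite_chain_property mu GG /\ sigma_decomposable mu GG;
       norm_modulo_constants mu p GG;
       Banach_modulo_constants mu p GG].
Proof.
have normi : norm_modulo_constants mu p GG ->
    finite_chain_property mu GG /\ sigma_decomposable mu GG.
  by move=> normc; split;
    [exact: norm_modulo_constants_chain normc
    |exact: norm_modulo_constants_sigma_decomposable normc].
tfae.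
- by move=> [fcp sdec]; exact: chain_sigma_norm_modulo_constants.
- by move=> normc; split=> //; apply: chain_quotient_complete => //;
    have [] := normi normc.
- by move=> [normc _]; exact: normi.
Qed.
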